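(* Let $p$ be a prime number and $n\geq 3$ an integer. Let $F$ be a field such that $F$ contains a primitive $p$-th root of unity if $\mathrm{char}(F)\neq p$, and such that $-1\in F^2$ if $p=2$. Let $G$ be either the absolute Galois group $G_F$ of $F$ or its maximal pro-$p$ quotient $G_F(p)$. Then for every $\chi\in H^1(G,\mathbb{F}_p)$, the $n$-fold Massey product $\langle \chi,\ldots,\chi\rangle$ (with $n$ entries equal to $\chi$) is defined and contains $0$.
   Context: Let $G$ be a profinite group, $\mathbb{F}_p$ the trivial discrete $G$-module, and $\mathcal{C}^\bullet(G,\mathbb{F}_p)$ the standard inhomogeneous continuous cochain complex with differential $\delta$ and cup product $\cup$; $H^i(G,\mathbb{F}_p)$ its cohomology. For $\alpha_1,\ldots,\alpha_n\in H^1(G,\mathbb{F}_p)$, a defining system for the $n$-fold Massey product $\langle\alpha_1,\ldots,\alpha_n\rangle$ is a collection $M=(a_{ij})$, $1\leq i<j\leq n+1$, $(i,j)\neq(1,n+1)$, of elements of $\mathcal{C}^1(G,\mathbb{F}_p)$ such that $a_{i,i+1}$ represents $\alpha_i$ and $\delta a_{ij}=\sum_{l=i+1}^{j-1}a_{il}\cup a_{lj}$ for $i+1<j$. Then $\sum_{k=2}^{n}a_{1k}\cup a_{k,n+1}$ is a $2$-cocycle, whose class is the value $\langle\alpha_1,\ldots,\alpha_n\rangle_M$. The Massey product $\langle\alpha_1,\ldots,\alpha_n\rangle\subseteq H^2(G,\mathbb{F}_p)$ is the set of all values over all defining systems; it is said to be defined if a defining system exists. *)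

(* Defs.v *)
From HB Require Import structures.
From mathcomp Require Import all_boot all_order all_algebra.
From mathcomp Require Import separable.
Set Implicit Arguments. Unset Strict Implicit. Unset Printing Implicit Defensive.
Import Order.TTheory GRing.Theory Num.Theory.
Local Open Scope ring_scope.

(* Setting: F a field, Om a separable closure of F (via iota : F -> Om).
   Elements of G_F = Aut(Om/F) are represented as functions Om -> Om
   satisfying [isGalEl]; the group law is composition (s * t)(x) = s (t x). *)

Definition isGalEl (F Om : fieldType) (iota : F -> Om) (s : Om -> Om) : Prop :=
  [/\ (forall x y, s (x + y) = s x + s y),
      (forall x y, s (x * y) = s x * s y),
      s 1 = 1,
      bijective s &
      (forall c, s (iota c) = iota c)].

Definition sep_closed (Om : fieldType) : Prop :=
  forall q : {poly Om}, (1 < size q)%N -> separable_poly q -> exists x, root q x.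

Definition sep_algebraic (F Om : fieldType) (iota : {rmorphism F -> Om}) : Prop :=
  forall x : Om, exists q : {poly F},
    [/\ q != 0, separable_poly q & root (map_poly iota q) x].

(* x lies in F(p), the maximal p-extension of F inside Om: x belongs to a finite
   G_F-stable set O whose set of restrictions {s|_O : s in G_F} (= Gal(F(O)/F))
   has p-power cardinality. *)
Definition in_max_p_ext (p : nat) (F Om : fieldType) (iota : F -> Om) (x : Om) : Prop :=
  exists O : seq Om,
    [/\ x \in O,
        (forall s, isGalEl iota s -> forall y, y \in O -> s y \in O) &
        exists (R : seq (seq Om)) (k : nat),
          [/\ uniq R, size R = (p ^ k)%N,
              (forall s, isGalEl iota s -> map s O \in R) &
              (forall r, r \in R -> exists s, isGalEl iota s /\ map s O = r)]].

(* Admissible elements whose stabilizers define the topology: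
   pro_p = false : G = G_F (Krull topology: all of Om);
   pro_p = true  : G = G_F(p) = Gal(F(p)/F) (cochains on G_F(p) are identified,
                   via inflation, with cochains on G_F factoring through G_F(p)). *)
Definition adm (pro_p : bool) (p : nat) (F Om : fieldType) (iota : F -> Om) (x : Om) : Prop :=
  if pro_p then in_max_p_ext p iota x else True.

Definition cont_cochain1 (pro_p : bool) (p : nat) (F Om : fieldType) (iota : F -> Om)
  (a : (Om -> Om) -> 'F_p) : Prop :=
  exists S : seq Om,
    (forall x, x \in S -> adm pro_p p iota x) /\
    (forall s t, isGalEl iota s -> isGalEl iota t -> {in S, s =1 t} -> a s = a t).

Definition delta1 (p : nat) (Om : Type) (a : (Om -> Om) -> 'F_p) (s t : Om -> Om) : 'F_p :=
  a t - a (fun x => s (t x)) + a s.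

Definition cup11 (p : nat) (Om : Type) (a b : (Om -> Om) -> 'F_p) (s t : Om -> Om) : 'F_p :=
  a s * b t.

(* Elements of H^1(G,F_p): continuous homomorphisms (1-cocycles; 1-coboundaries
   are zero for the trivial module). *)
Definition is_H1 (pro_p : bool) (p : nat) (F Om : fieldType) (iota : F -> Om)
  (chi : (Om -> Om) -> 'F_p) : Prop :=
  cont_cochain1 pro_p iota chi /\
  (forall s t, isGalEl iota s -> isGalEl iota t -> delta1 chi s t = 0).

Definition defining_system (pro_p : bool) (p : nat) (F Om : fieldType) (iota : F -> Om)
  (n : nat) (chis : nat -> (Om -> Om) -> 'F_p)
  (a : nat -> nat -> (Om -> Om) -> 'F_p) : Prop :=
  forall i j, (1 <= i)%N -> (i < j)%N -> (j <= n.+1)%N -> (i, j) <> (1%N, n.+1) ->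
    [/\ cont_cochain1 pro_p iota (a i j),
        (j = i.+1 -> forall s, isGalEl iota s -> a i j s = chis i s) &
        ((i.+1 < j)%N -> forall s t, isGalEl iota s -> isGalEl iota t ->
            delta1 (a i j) s t = \sum_(i.+1 <= l < j) cup11 (a i l) (a l j) s t)].

Definition massey_value (p : nat) (Om : Type) (n : nat)
  (a : nat -> nat -> (Om -> Om) -> 'F_p) (s t : Om -> Om) : 'F_p :=
  \sum_(2 <= k < n.+1) cup11 (a 1%N k) (a k n.+1) s t.

Definition is_coboundary2 (pro_p : bool) (p : nat) (F Om : fieldType) (iota : F -> Om)
  (c : (Om -> Om) -> (Om -> Om) -> 'F_p) : Prop :=
  exists b : (Om -> Om) -> 'F_p, cont_cochain1 pro_p iota b /\
    (forall s t, isGalEl iota s -> isGalEl iota t -> c s t = delta1 b s t).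

Definition massey_contains_zero (pro_p : bool) (p : nat) (F Om : fieldType) (iota : F -> Om)
  (n : nat) (chis : nat -> (Om -> Om) -> 'F_p) : Prop :=
  exists a, defining_system pro_p iota n chis a /\
            is_coboundary2 pro_p iota (massey_value n a).

(* Main.v *)
(* It suffices to lift [chi] to a continuous unipotent representation of size
   n + 1 over F_p all of whose superdiagonal entries are [chi].
   If F has characteristic p, such a lift comes from Artin-Schreier theory: the
   equation Frob(X) = X (1 + a T) can be solved by truncated power series, and
   s X = X W_s defines the representation. Otherwise [chi] is the Kummer
   character of some y, and an element s of the group sends a p^k-th root Y of y
   to zeta^c(s) Y and zeta to zeta^kappa(s); the affine maps
   x -> kappa(s) x + c(s) act on F_p[T] / (T^(n+1)), through 1 + T = exp x,
   by T^i |-> (1 + T)^c(s) ((1 + T)^kappa(s) - 1)^i. The roots of unity in F give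
   kappa(s) = 1 mod p, and mod 4 if p = 2, so this action is unipotent with
   superdiagonal c(s) mod p = chi(s). The Galois-theoretic input reduces to
   Hilbert 90, which follows from the independence of characters. *)
Require Import Defs.
From HB Require Import structures.
From mathcomp Require Import all_boot all_order all_algebra.
From mathcomp Require Import all_fingroup all_solvable all_field.
From mathcomp Require Import zify ring.
From Stdlib Require Import Classical ClassicalEpsilon.
Set Implicit Arguments. Unset Strict Implicit. Unset Printing Implicit Defensive.
Import GRing.Theory.
Local Open Scope ring_scope.

(** * Hilbert 90 *)

(** Replaces a finite quotient with a chosen transversal: [R] lists attained values of [f], among
    them all those in [L], and [g] is a section over it. Induction on [L] decides classically
    whether each value is attained. *)
Lemma finite_representatives (A : Type) (T : eqType) (P : A -> Prop)
    (f : A -> T) (a0 : A) (L : seq T) :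
  exists (R : seq T) (g : T -> A),
    [/\ uniq R, forall a, P a -> f a \in L -> f a \in R
      & forall r, r \in R -> P (g r) /\ f (g r) = r].
Proof.
elim: L => [|r0 L [R [g [uR sR gR]]]]; first by exists [::], (fun=> a0).
case: (boolP (r0 \in R)) => [r0R | r0R].
  exists R, g; split=> // a Pa; rewrite inE => /predU1P[-> // | ]; exact: sR.
case: (classic (exists a, P a /\ f a = r0)) => [[a1 [Pa1 fa1]] | no_a].
  exists (r0 :: R), (fun r => if r == r0 then a1 else g r); split.
  - by rewrite /= r0R.
  - by move=> a Pa; rewrite !inE; case: eqP => //= _; apply: sR.
  - move=> r; rewrite inE; case: eqP => [-> // | _ /=]; exact: gR.
exists R, g; split=> // a Pa; rewrite inE => /predU1P[fa | ]; last exact: sR.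
by case: no_a; exists a.
Qed.

Lemma finite_roots (K : fieldType) (q : {poly K}) :
  q != 0 -> exists rs : seq K, forall x, root q x -> x \in rs.
Proof.
have [m] := ubnP (size q); elim: m q => // m IHm q lt_q_m q0.
case: (classic (exists x, root q x)) => [[x qx] | no_x]; last first.
  by exists [::] => x qx; case: no_x; exists x.
have [q1 Dq] := factor_theorem _ _ qx.
have q10: q1 != 0 by apply: contraNneq q0 => q10; rewrite Dq q10 mul0r.
have [|rs rsP] := IHm q1 _ q10.
  by move: lt_q_m; rewrite Dq size_Mmonic ?monicXsubC // size_XsubC addn2.
exists (x :: rs) => y; rewrite Dq rootM root_XsubC inE orbC.
by case/orP=> [-> // | /rsP->]; rewrite orbT.
Qed.

Lemma gal_rmorphism (F Om : fieldType) (iota : F -> Om) (s : Om -> Om) :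
  isGalEl iota s -> exists f : {rmorphism Om -> Om}, s = f.
Proof.
case=> sD sM s1 _ _.
have sB : zmod_morphism s.
  by move=> x y; apply/eqP; rewrite eq_sym subr_eq -sD subrK.
have sMM : monoid_morphism s by split.
pose fA := GRing.isZmodMorphism.Build Om Om s sB.
pose fM := GRing.isMonoidMorphism.Build Om Om s sMM.
pose f : {rmorphism Om -> Om} := HB.pack s fA fM.
by exists f.
Qed.

Lemma gal_id (F Om : fieldType) (iota : F -> Om) : isGalEl iota id.
Proof. by split=> //; exists id. Qed.

Lemma gal_comp (F Om : fieldType) (iota : F -> Om) (s t : Om -> Om) :
  isGalEl iota s -> isGalEl iota t -> isGalEl iota (fun x => s (t x)).
Proof.
case=> sD sM s1 bs sc [tD tM t1 bt tc]; split=> [x y|x y|||c].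
- by rewrite tD sD.
- by rewrite tM sM.
- by rewrite t1.
- exact: (bij_comp bs bt).
- by rewrite tc.
Qed.

Lemma gal_iter (F Om : fieldType) (iota : F -> Om) (s : Om -> Om) (k : nat) :
  isGalEl iota s -> isGalEl iota (iter k s).
Proof.
move=> Gs; elim: k => [|k IHk] /=; first exact: gal_id.
exact: (gal_comp Gs IHk).
Qed.

Lemma gal_inj (F Om : fieldType) (iota : F -> Om) (s : Om -> Om) :
  isGalEl iota s -> injective s.
Proof. by case=> _ _ _ /bij_inj. Qed.

Lemma gal_inv (F Om : fieldType) (iota : F -> Om) (s : Om -> Om) :
  isGalEl iota s -> exists t, [/\ isGalEl iota t, cancel s t & cancel t s].
Proof.
move=> Gs; have sI := gal_inj Gs; case: Gs => sD sM s1 [t st ts] sc.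
exists t; split=> //; split=> [x y|x y|||c].
- by apply: sI; rewrite sD !ts.
- by apply: sI; rewrite sM !ts.
- by rewrite -s1 st.
- by exists s.
- by apply: sI; rewrite ts sc.
Qed.

(** The group permutes the roots of any polynomial over [F] that kills [x]. *)
Lemma finite_conjugates (F Om : fieldType) (iota : {rmorphism F -> Om}) (x : Om) :
  sep_algebraic iota ->
  exists rs : seq Om, forall s, isGalEl iota s -> s x \in rs.
Proof.
move=> algO; have [q [q0 _ qx]] := algO x.
have [|rs rsP] := @finite_roots _ (map_poly iota q); first by rewrite map_poly_eq0.
exists rs => s Gs; apply: rsP.
have [f sf] := gal_rmorphism Gs; case: Gs => _ _ _ _ sc.
have <-: map_poly f (map_poly iota q) = map_poly iota q.
  by rewrite -map_poly_comp; apply: eq_map_poly => c /=; rewrite -sf sc.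
by rewrite sf fmorph_root.
Qed.

(** [R] stands for the finite set of cosets of the pointwise stabilizer of [S], and [g] picks a
    representative of each coset. *)
Lemma finite_restrictions (F Om : fieldType) (iota : {rmorphism F -> Om})
    (S : seq Om) :
  sep_algebraic iota ->
  exists (R : seq (seq Om)) (g : seq Om -> Om -> Om),
    [/\ uniq R, forall s, isGalEl iota s -> map s S \in R
      & forall r, r \in R -> isGalEl iota (g r) /\ map (g r) S = r].
Proof.
move=> algO.
have [L LP]: exists L : seq (seq Om), forall s, isGalEl iota s -> map s S \in L.
  elim: S => [|x S [L LP]]; first by exists [:: [::]] => s _; rewrite inE.
  have [rs rsP] := finite_conjugates x algO.
  exists [seq y :: l | y <- rs, l <- L] => s Gs; rewrite map_cons.
  by apply: allpairs_f; [apply: rsP | apply: LP].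
have [R [g [uR RP gR]]] :=
  finite_representatives (isGalEl iota) (fun s => map s S) id L.
by exists R, g; split=> // s Gs; apply: RP (LP s Gs).
Qed.

(* Artin's argument that distinct characters are linearly independent; only
   elements [w] whose images are determined by restrictions to [S] are needed. *)
Lemma restrictions_independent (F Om : fieldType) (iota : F -> Om) (S : seq Om)
    (R : seq (seq Om)) (g : seq Om -> Om -> Om) (lam : seq Om -> Om) :
  uniq R ->
  (forall r, r \in R -> isGalEl iota (g r) /\ map (g r) S = r) ->
  (forall w, (forall s t, isGalEl iota s -> isGalEl iota t ->
                {in S, s =1 t} -> s w = t w) ->
    \sum_(r <- R) lam r * g r w = 0) ->
  forall r, r \in R -> lam r = 0.
Proof.
elim: R lam => // r0 R IHR lam /= /andP[r0R uR] gR sum0.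
have [G0 Dr0] := gR _ (mem_head _ _).
have gR' r : r \in R -> isGalEl iota (g r) /\ map (g r) S = r.
  by move=> rR; apply: gR; rewrite inE rR orbT.
have lamR r : r \in R -> lam r = 0.
  move=> rR; have [Gr Dr] := gR' r rR.
  have [a aS neq_a] : exists2 a, a \in S & g r a != g r0 a.
    apply/hasP; apply: contraNT r0R => /hasPn eq_rr0.
    rewrite -Dr0 (_ : map _ _ = r) // -Dr; apply/esym/eq_in_map => a /eq_rr0.
    by rewrite negbK => /eqP.
  suff: lam r * (g r a - g r0 a) = 0.
    by move/eqP; rewrite mulf_eq0 subr_eq0 (negPf neq_a) orbF => /eqP.
  (* Subtracting [g r0 a] times the relation at [w] from the relation at [a * w] cancels the [r0]
     term, which leaves a shorter relation over [R]. *)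
  apply: (IHR (fun r => lam r * (g r a - g r0 a)) uR gR' _ r rR) => w wS.
  have waS s t : isGalEl iota s -> isGalEl iota t -> {in S, s =1 t} ->
      s (a * w) = t (a * w).
    move=> Gs Gt st; case: (Gs) => _ sM _ _ _; case: (Gt) => _ tM _ _ _.
    by rewrite sM tM st // (wS s t).
  have := sum0 _ waS; rewrite big_cons; case: (G0) => _ gM _ _ _.
  rewrite gM mulrCA => eq0.
  have := congr1 ( *%R (g r0 a)) (sum0 _ wS).
  rewrite big_cons mulr0 mulrDr -[RHS]eq0 => /addrI; rewrite mulr_sumr => eqs.
  apply/eqP; rewrite (eq_big_seq (fun r => lam r * g r (a * w) -
      g r0 a * (lam r * g r w))); first by rewrite sumrB -eqs subrr.
  move=> r1 r1R; have [[_ -> _ _ _] _] := gR' _ r1R.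
  by rewrite mulrBr mulrBl mulrA [g r0 a * _]mulrCA [lam r1 * _ * _]mulrAC mulrA mulrAC.
move=> r; rewrite inE => /predU1P[->|/lamR //].
have := sum0 1; rewrite big_cons big1_seq => [|r1 /andP[_ /lamR->]]; last by rewrite mul0r.
case: G0 => _ _ -> _ _; rewrite mulr1 addr0; apply=> s t.
by case=> _ _ -> _ _ [_ _ -> _ _].
Qed.

(** Left translation by [s] permutes the cosets of the stabilizer of [S], and [Phi] is constant on
    each coset. *)
Lemma sum_restrictions_shift (F Om : fieldType) (iota : F -> Om) (S : seq Om)
    (R : seq (seq Om)) (g : seq Om -> Om -> Om) (Phi : (Om -> Om) -> Om)
    (s : Om -> Om) :
  uniq R -> (forall s, isGalEl iota s -> map s S \in R) ->
  (forall r, r \in R -> isGalEl iota (g r) /\ map (g r) S = r) ->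
  (forall s t, isGalEl iota s -> isGalEl iota t -> {in S, s =1 t} ->
     Phi s = Phi t) ->
  isGalEl iota s ->
  \sum_(r <- R) Phi (fun x => s (g r x)) = \sum_(r <- R) Phi (g r).
Proof.
move=> uR RP gR PhiS Gs.
have sR r : r \in R -> map s r \in R.
  move=> /gR[Gr <-]; rewrite -map_comp; exact: RP (gal_comp Gs Gr).
have permR : perm_eq (map (map s) R) R.
  have uR' : uniq (map (map s) R).
    by rewrite map_inj_uniq //; apply/inj_map/(gal_inj Gs).
  have sub : {subset map (map s) R <= R} by move=> _ /mapP[r rR ->]; apply: sR.
  have [|_ eqR] := uniq_min_size uR' sub; first by rewrite size_map.
  exact: uniq_perm.
rewrite -[RHS](perm_big _ permR) big_map; apply: eq_big_seq => r rR.
have [Gr Dr] := gR r rR; have [Gsr Dsr] := gR _ (sR r rR).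
apply: PhiS => //; first exact: gal_comp.
by apply/eq_in_map; rewrite [RHS]Dsr -[in RHS]Dr -map_comp.
Qed.

(* The Lagrange resolvent. *)
Lemma hilbert90_mul (F Om : fieldType) (iota : {rmorphism F -> Om}) (S : seq Om)
    (u : (Om -> Om) -> Om) :
  sep_algebraic iota ->
  (forall s t, isGalEl iota s -> isGalEl iota t -> {in S, s =1 t} -> u s = u t) ->
  (forall s, isGalEl iota s -> u s != 0) ->
  (forall s t, isGalEl iota s -> isGalEl iota t ->
     u (fun x => s (t x)) = u s * u t) ->
  (forall s t, isGalEl iota s -> isGalEl iota t -> s (u t) = u t) ->
  exists2 y, y != 0 & forall s, isGalEl iota s -> s y = u s * y.
Proof.
move=> algO uS u0 uM uc.
have [R [g [uR RP gR]]] := finite_restrictions S algO.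
case: (classic (forall w, (forall s t, isGalEl iota s -> isGalEl iota t ->
          {in S, s =1 t} -> s w = t w) ->
    \sum_(r <- R) (u (g r))^-1 * g r w = 0)) => [sum0 | ].
  have idR : map id S \in R := RP _ (gal_id iota).
  have /eqP := restrictions_independent uR gR sum0 idR.
  by rewrite invr_eq0 (negPf (u0 _ (gR _ idR).1)).
move/not_all_ex_not=> [w nw]; have [wS /eqP sum_neq0] := imply_to_and _ _ nw.
exists (\sum_(r <- R) (u (g r))^-1 * g r w) => // s Gs.
rewrite -[in RHS](@sum_restrictions_shift _ _ iota S R g (fun t => (u t)^-1 * t w) s) //; last first.
  by move=> t1 t2 G1 G2 t12; rewrite (uS t1 t2) ?(wS t1 t2).
have [f sf] := gal_rmorphism Gs; rewrite [in LHS]sf rmorph_sum -sf mulr_sumr.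
apply: eq_big_seq => r rR; have [Gr _] := gR r rR.
rewrite /= [in LHS]sf rmorphM fmorphV -sf uc // (uM _ _ Gs Gr) invfM !mulrA.
by rewrite divff ?u0 ?mul1r.
Qed.

(** Independence gives [w] with nonzero trace [Tr]; minus the sum of the [u r * r w], divided by
    [Tr], is a solution because [u r = u (s r) - u s]. *)
Lemma hilbert90_add (F Om : fieldType) (iota : {rmorphism F -> Om}) (S : seq Om)
    (u : (Om -> Om) -> Om) :
  sep_algebraic iota ->
  (forall s t, isGalEl iota s -> isGalEl iota t -> {in S, s =1 t} -> u s = u t) ->
  (forall s t, isGalEl iota s -> isGalEl iota t ->
     u (fun x => s (t x)) = u s + u t) ->
  (forall s t, isGalEl iota s -> isGalEl iota t -> s (u t) = u t) ->
  exists y, forall s, isGalEl iota s -> s y = u s + y.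
Proof.
move=> algO uS uD uc.
have [R [g [uR RP gR]]] := finite_restrictions S algO.
case: (classic (forall w, (forall s t, isGalEl iota s -> isGalEl iota t ->
          {in S, s =1 t} -> s w = t w) ->
    \sum_(r <- R) 1 * g r w = 0)) => [sum0 | ].
  have idR : map id S \in R := RP _ (gal_id iota).
  have /eqP := @restrictions_independent _ _ iota S R g (fun=> 1) uR gR sum0 _ idR.
  by rewrite oner_eq0.
move/not_all_ex_not=> [w nw]; have [wS /eqP] := imply_to_and _ _ nw.
under eq_bigr do rewrite mul1r.
set Tr := \sum_(r <- R) _ => Tr0.
have shift := @sum_restrictions_shift _ _ iota S R g _ _ uR RP gR.
have sTr s : isGalEl iota s -> s Tr = Tr.
  move=> Gs; have [f sf] := gal_rmorphism Gs.
  rewrite [in LHS]sf rmorph_sum -sf; exact: (shift (fun t => t w)).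
exists (- (\sum_(r <- R) u (g r) * g r w) / Tr) => s Gs.
have [f sf] := gal_rmorphism Gs.
rewrite [in LHS]sf rmorphM rmorphN fmorphV rmorph_sum -sf sTr //.
rewrite -[in RHS](shift (fun t => u t * t w) s) //; last first.
  by move=> t1 t2 G1 G2 t12; rewrite (uS t1 t2) ?(wS t1 t2).
rewrite (eq_big_seq (fun r => u (fun x => s (g r x)) * s (g r w) - u s * s (g r w))).
  rewrite sumrB -mulr_sumr [\sum_(r <- R) s _](shift (fun t => t w)) // -/Tr.
  by rewrite opprB mulrBl mulfK // mulNr.
move=> r rR; have [Gr _] := gR r rR.
by rewrite /= [in LHS]sf rmorphM -sf uc // (uD _ _ Gs Gr) mulrDl [u s * _ + _]addrC addrK.
Qed.

(** * Maximal p-extensions and unipotent representations *)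

(** The group acts on the finite orbit of [x] through a group of permutations whose elements all
    have order dividing [p ^ m]; by Cauchy's theorem this is a p-group. *)
Lemma in_max_p_ext_of_iter (p m : nat) (F Om : fieldType)
    (iota : {rmorphism F -> Om}) (x : Om) :
  prime p -> sep_algebraic iota ->
  (forall s, isGalEl iota s -> iter (p ^ m) s x = x) ->
  in_max_p_ext p iota x.
Proof.
move=> p_pr algO iter_x.
have [rs rsP] := finite_conjugates x algO.
have [O [rep [_ OP repP]]] :=
  finite_representatives (isGalEl iota) (fun s => s x) id rs.
have GO s : isGalEl iota s -> s x \in O by move=> Gs; apply: OP (rsP s Gs).
have stabO s : isGalEl iota s -> forall y, y \in O -> s y \in O.
  move=> Gs y /repP[Gt <-]; exact: GO (gal_comp Gs Gt).
(* Another point of the orbit is [t x]; conjugating [s] by [t] brings the claim back to [x]. *)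
have iterO s y : isGalEl iota s -> y \in O -> iter (p ^ m) s y = y.
  move=> Gs /repP[]; move: (rep y) => t Gt <-.
  have [t' [Gt' tK t'K]] := gal_inv Gt.
  have := iter_x _ (gal_comp Gt' (gal_comp Gs Gt)).
  suff -> k : iter k (fun z => t' (s (t z))) x = t' (iter k s (t x)).
    by move=> /(congr1 t); rewrite t'K.
  by elim: k => [|k IHk] /=; rewrite ?tK // IHk t'K.
(* The default [1] is reached only by functions that induce no permutation of [O]. *)
pose toperm (s : Om -> Om) : {perm seq_sub O} :=
  odflt 1%g [pick sg : {perm seq_sub O} | [forall y, val (sg y) == s (val y)]].
have topermE s y : isGalEl iota s -> val (toperm s y) = s (val y).
  move=> Gs; rewrite /toperm; case: pickP => [sg /forallP/(_ y)/eqP// | no_sg].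
  pose h (y : seq_sub O) : seq_sub O := SeqSub (stabO s Gs _ (valP y)).
  have hI : injective h.
    by move=> y1 y2 /(congr1 val)/(gal_inj Gs)/val_inj.
  have /forallP[] := no_sg (perm hI).
  by move=> z; rewrite permE.
have topermM s t : isGalEl iota s -> isGalEl iota t ->
    toperm (fun x => s (t x)) = (toperm t * toperm s)%g.
  move=> Gs Gt; apply/permP=> y; apply: val_inj.
  by rewrite permM !topermE //; apply: gal_comp.
have toperm1 : toperm id = 1%g.
  by apply/permP=> y; apply: val_inj; rewrite topermE ?perm1 //; apply: gal_id.
have topermX s k : isGalEl iota s -> toperm (iter k s) = (toperm s ^+ k)%g.
  move=> Gs; elim: k => [|k IHk] //; rewrite expgSr -IHk -topermM //.
  exact: gal_iter.
have [P [lif [uP PP lifP]]] :=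
  finite_representatives (isGalEl iota) toperm id (enum {perm seq_sub O}).
have inP s : isGalEl iota s -> toperm s \in P.
  by move=> Gs; apply: PP => //; rewrite mem_enum.
have gP : group_set [set sg in P].
  apply/group_setP; split=> [|a b]; rewrite !inE.
    by rewrite -toperm1; apply: inP; apply: gal_id.
  move=> /lifP[Ga <-] /lifP[Gb <-]; rewrite -topermM //.
  exact: inP (gal_comp Gb Ga).
pose G := group gP.
have cardG : #|G| = size P.
  by rewrite -(card_uniqP uP); apply: eq_card => sg; rewrite inE.
have pG : (p.-group G)%g.
  apply/pgroupP=> r r_pr /(Cauchy r_pr)[sg sgG or].
  have [Gs sg_s] : isGalEl iota (lif sg) /\ toperm (lif sg) = sg.
    by apply: lifP; rewrite /= inE in sgG.
  have : ((#[sg])%g %| p ^ m)%N.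
    rewrite order_dvdn -sg_s -topermX //; apply/eqP/permP=> y; apply: val_inj.
    by rewrite topermE ?perm1 ?iterO ?(valP y) //; apply: gal_iter.
  by rewrite or Euclid_dvdX // dvdn_prime2 // inE => /andP[/eqP->].
exists O; split=> //; first exact: (GO id (gal_id iota)).
have lif_toperm s y : isGalEl iota s -> y \in O -> lif (toperm s) y = s y.
  move=> Gs yO; have [Gl ls] := lifP _ (inP s Gs).
  by rewrite -[y]/(val (SeqSub yO)) -!topermE // ls.
exists [seq map (lif sg) O | sg <- P], (logn p #|G|); split.
- rewrite map_inj_in_uniq // => a b /lifP[Ga Da] /lifP[Gb Db] /eq_in_map ab.
  rewrite -Da -Db; apply/permP=> y; apply: val_inj.
  by rewrite !topermE // ab // (valP y).
- by rewrite size_map -cardG -card_pgroup.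
- move=> s Gs; apply/mapP; exists (toperm s); first exact: inP.
  by apply/eq_in_map => y yO; rewrite lif_toperm.
- by move=> r /mapP[sg /lifP[Gs _] ->]; exists (lif sg).
Qed.

(* The signs turn [rho (s t) = rho s * rho t] into the relations of a defining
   system; the corner entry of [rho] bounds the Massey value. *)
Lemma massey_contains_zero_of_unipotent (pro_p : bool) (p n : nat)
    (F Om : fieldType) (iota : F -> Om) (chi : (Om -> Om) -> 'F_p)
    (rho : nat -> nat -> (Om -> Om) -> 'F_p) :
  (1 < n)%N ->
  (forall i j, cont_cochain1 pro_p iota (rho i j)) ->
  (forall i s, isGalEl iota s -> (i < n)%N -> rho i.+1 i.+2 s = chi s) ->
  (forall i s, isGalEl iota s -> (0 < i <= n.+1)%N -> rho i i s = 1) ->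
  (forall i j s t, isGalEl iota s -> isGalEl iota t ->
     (0 < i)%N -> (i < j)%N -> (j <= n.+1)%N ->
     rho i j (fun x => s (t x)) = \sum_(i <= l < j.+1) rho i l s * rho l j t) ->
  massey_contains_zero pro_p iota n (fun _ => chi).
Proof.
move=> n1 rho_cont rho_chi rho1 rhoM.
pose a i j s := (-1) ^+ (j - i).+1 * rho i j s.
have aC i j : cont_cochain1 pro_p iota (a i j).
  have [S [admS dS]] := rho_cont i j; exists S; split=> // s t Gs Gt st.
  by rewrite /a (dS s t).
have aM i j s t : isGalEl iota s -> isGalEl iota t ->
     (0 < i)%N -> (i < j)%N -> (j <= n.+1)%N ->
     delta1 (a i j) s t = \sum_(i.+1 <= l < j) cup11 (a i l) (a l j) s t.
  move=> Gs Gt i0 ij jn.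
  have rho_ii : rho i i s = 1 by apply: rho1; rewrite ?i0 ?(leq_trans (ltnW ij)).
  have rho_jj : rho j j t = 1 by apply: rho1; rewrite ?jn ?(leq_trans _ ij).
  (* The extreme terms [l = i] and [l = j] of the matrix product have a diagonal factor 1 and cancel
     the outer terms of [delta1]. *)
  rewrite /delta1 /a (rhoM i j s t) // big_ltn ?ltnS ?(ltnW ij) //.
  rewrite big_nat_recr //= rho_ii rho_jj mul1r mulr1 !mulrDr.
  rewrite opprD addrA subrr sub0r opprD subrK mulr_sumr -sumrN.
  apply: eq_big_nat => l /andP[il lj]; rewrite /cup11 mulrACA -exprD.
  have -> : ((l - i).+1 + (j - l).+1 = (j - i).+2)%N by lia.
  by rewrite [in RHS]exprS mulN1r mulNr.
exists a; split; last first.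
  exists (a 1%N n.+1); split=> // s t Gs Gt.
  by rewrite aM // ltnS ltnW.
move=> i j i1 ij jn _; split=> // [Dj s Gs | ij1 s t Gs Gt].
  rewrite /a Dj subSnn expr2 mulN1r opprK mul1r.
  by case: i i1 {ij} Dj => // i _ Dj; apply: rho_chi; rewrite // -ltnS -Dj.
exact: aM.
Qed.

(** * Characteristic p *)

Lemma Fp_rmorphism (p : nat) (K : fieldType) :
  p \in [pchar K] ->
  exists f : {rmorphism 'F_p -> K}, forall u, f u = (u : nat)%:R.
Proof.
move=> pK; have p_pr := pcharf_prime pK.
pose h (u : 'F_p) : K := (u : nat)%:R.
have hnat k : h k%:R = k%:R.
  rewrite /h val_Fp_nat // [in RHS](divn_eq k p) natrD natrM.
  by rewrite (pcharf0 pK) mulr0 add0r.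
have hB : zmod_morphism h.
  suff hD u v : h (u + v) = h u + h v.
    by move=> u v; apply/eqP; rewrite eq_sym subr_eq -hD subrK.
  by rewrite -[u]natr_Zp -[v]natr_Zp -natrD !hnat natrD.
have hM : monoid_morphism h.
  split=> [|u v]; first exact: (hnat 1).
  by rewrite -[u]natr_Zp -[v]natr_Zp -natrM !hnat natrM.
pose hA := GRing.isZmodMorphism.Build 'F_p K h hB.
pose hMM := GRing.isMonoidMorphism.Build 'F_p K h hM.
pose f : {rmorphism 'F_p -> K} := HB.pack h hA hMM.
by exists f.
Qed.

(** The image of [F_p] already supplies the [p] roots that [X^p - X] can have. *)
Lemma Frobenius_fixed_Fp (p : nat) (K : fieldType) (f : {rmorphism 'F_p -> K})
    (e : K) :
  prime p -> e ^+ p = e -> exists u, e = f u.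
Proof.
move=> p_pr ep; apply: NNPP => no_u.
pose P : {poly K} := 'X^p - 'X.
have szP : size P = p.+1.
  rewrite /P size_polyDl ?size_polyXn // size_polyN size_polyX.
  by rewrite !ltnS prime_gt1.
have P0 : P != 0 by rewrite -size_poly_eq0 szP.
have rP x : x ^+ p = x -> root P x.
  by move=> xp; rewrite /root /P !hornerE xp subrr.
have rE : all (root P) (e :: map f (enum 'F_p)).
  rewrite /= rP //=; apply/allP => _ /mapP[u _ ->]; apply: rP.
  by rewrite -rmorphXn -[in X in _ ^+ X](card_Fp p_pr) expf_card.
have uE : uniq (e :: map f (enum 'F_p)).
  rewrite /= (map_inj_uniq (fmorph_inj f)) enum_uniq andbT.
  by apply/mapP => -[u _ Du]; apply: no_u; exists u.
have := max_poly_roots P0 rE uE.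
by rewrite szP /= size_map -cardE card_Fp // ltnn.
Qed.

(** The polynomial has derivative [-1], hence is separable. *)
Lemma artin_schreier_root (p : nat) (K : fieldType) (b : K) :
  p \in [pchar K] -> sep_closed K -> exists x, root ('X^p - 'X - b%:P) x.
Proof.
move=> pK sepK; have p_pr := pcharf_prime pK.
apply: sepK.
  rewrite -addrA -opprD size_polyDl ?size_polyXn ?ltnS ?prime_gt0 //.
  by rewrite size_polyN size_XaddC prime_gt1.
rewrite separable_poly.unlock !derivB derivXn derivX derivC subr0.
rewrite -mulr_natr -polyC_natr (pcharf0 pK) polyC0 mulr0 sub0r.
by rewrite coprimep_sym -scaleN1r coprimepZl ?oppr_eq0 ?oner_eq0 ?coprime1p.
Qed.

(* The unipotent representation is obtained by trivialising it over [Om]: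
   a power series [X] with [Frob X = X * (1 + a T)] satisfies [s X = X * W s]
   with [W s] invariant under Frobenius. *)
Lemma massey_pchar (pro_p : bool) (p n : nat) (F Om : fieldType)
    (iota : {rmorphism F -> Om}) (chi : (Om -> Om) -> 'F_p) :
  (1 < n)%N -> p \in [pchar Om] -> sep_closed Om -> sep_algebraic iota ->
  is_H1 pro_p iota chi ->
  massey_contains_zero pro_p iota n (fun _ => chi).
Proof.
move=> n1 pK sepO algO [[S [_ chiS]] chiM].
have p_pr := pcharf_prime pK.
have [f fE] := Fp_rmorphism pK.
have chiD s t : isGalEl iota s -> isGalEl iota t ->
    chi (fun x => s (t x)) = chi s + chi t.
  move=> Gs Gt; have /eqP := chiM s t Gs Gt.
  by rewrite /delta1 addrAC subr_eq0 addrC => /eqP.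
have fix_f s u : isGalEl iota s -> s (f u) = f u.
  by move=> Gs; have [g ->] := gal_rmorphism Gs; rewrite fE rmorph_nat.
have [y yP] : exists y, forall s, isGalEl iota s -> s y = f (chi s) + y.
  apply: (hilbert90_add (S := S)) => //.
  - by move=> s t Gs Gt st; rewrite (chiS s t).
  - by move=> s t Gs Gt; rewrite chiD // rmorphD.
  - by move=> s t Gs Gt; apply: fix_f.
have fp u : f u ^+ p = f u.
  by rewrite -rmorphXn -[in X in _ ^+ X](card_Fp p_pr) expf_card.
have frobE z : pFrobenius_aut pK z = z ^+ p by [].
pose a := y ^+ p - y.
have sa s : isGalEl iota s -> s a = a.
  move=> Gs; have sy := yP s Gs; have [g Dg] := gal_rmorphism Gs.
  rewrite /a Dg rmorphB rmorphXn -Dg sy -frobE rmorphD /= !frobE fp.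
  by rewrite opprD addrACA subrr add0r.
pose sol b := xchoose (artin_schreier_root b pK sepO).
have solE b : sol b ^+ p = sol b + b.
  have := xchooseP (artin_schreier_root b pK sepO); rewrite -/(sol b).
  by rewrite /root !hornerE subr_eq0 subr_eq addrC => /eqP.
(* Coefficientwise, [Frob X = X * (1 + a T)] is a tower of Artin-Schreier equations. Taking [y]
   itself as the coefficient of degree 1, and not an arbitrary root, makes [(W s)_1] equal to
   [chi s]. *)
pose x := fix x m := match m with
  | 0 => 1 | m'.+1 => if m' is 0 then y else sol (a * x m') end.
have xS m : x m.+1 ^+ p = x m.+1 + a * x m.
  case: m => [|m]; last exact: solE.
  by rewrite /= mulr1 /a addrC subrK.
pose X := \poly_(i < n.+1) x i.
have XE m : (m <= n)%N -> X`_m = x m by rewrite coef_poly ltnS => ->.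
(* This is [s X = X * W] modulo [T^(k+1)]. *)
pose good s k (W : {poly 'F_p}) :=
  forall m, (m <= k)%N -> s (x m) = (X * map_poly f W)`_m.
have good_ex s : isGalEl iota s -> exists W, good s n W.
  move=> Gs; have [g Dg] := gal_rmorphism Gs.
  suff: forall k, (k <= n)%N -> exists W, good s k W by apply.
  elim=> [|k IHk] kn.
    exists 1 => m; rewrite leqn0 => /eqP->.
    by rewrite rmorph1 mulr1 XE // Dg rmorph1.
  have [W gW] := IHk (ltnW kn).
  (* The discrepancy [e] has to be the next coefficient of [W]. Its two terms satisfy the same
     Artin-Schreier equation, so [e] is fixed by Frobenius and lies in [F_p]. *)
  set e := s (x k.+1) - (X * map_poly f W)`_k.+1.
  have ep : e ^+ p = e.
    have sx : s (x k.+1) ^+ p = s (x k.+1) + a * s (x k).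
      have := congr1 g (xS k); rewrite rmorphXn rmorphD rmorphM -Dg.
      by rewrite sa.
    have Wx : (X * map_poly f W)`_k.+1 ^+ p =
              (X * map_poly f W)`_k.+1 + a * s (x k).
      rewrite gW // !coefM -frobE rmorph_sum /= [LHS]big_ord_recl.
      rewrite [in RHS]big_ord_recl -addrA; congr (_ + _).
        by rewrite !frobE exprMn coef_map /= fp XE // expr1n.
      rewrite mulr_sumr -big_split; apply: eq_bigr => i _ /=.
      have in_ : (i < n)%N by apply: leq_trans kn; apply: ltn_ord.
      rewrite !frobE exprMn coef_map /= fp /bump /= add1n subSS !XE ?(ltnW in_) //.
      by rewrite xS mulrDl mulrA.
    by rewrite /e -frobE rmorphB /= !frobE sx Wx opprD addrACA subrr addr0.
  have [u eu] := Frobenius_fixed_Fp f p_pr ep.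
  exists (W + u *: 'X^(k.+1)) => m mk.
  rewrite rmorphD /= map_polyZ map_polyXn mulrDr -scalerAr coefD coefZ coefMXn.
  move: mk; rewrite leq_eqVlt => /predU1P[-> | mk]; last first.
    by rewrite mk mulr0 addr0 gW.
  by rewrite ltnn subnn XE // mulr1 -eu /e addrC subrK.
(* [X] has constant term 1, hence is invertible modulo [T^(n+1)]. *)
have good_uniq s W V : good s n W -> good s n V ->
    forall m, (m <= n)%N -> W`_m = V`_m.
  move=> gW gV; elim/ltn_ind=> m IHm mn; apply: (fmorph_inj f).
  have := gW m mn; rewrite gV // !coefM !big_ord_recl subn0 XE //= !mul1r.
  rewrite !coef_map /= => /eqP; rewrite (eq_bigr (fun i : 'I_m =>
    X`_(bump 0 i) * (map_poly f W)`_(m - bump 0 i))).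
    by rewrite (inj_eq (addIr _)) => /eqP.
  move=> i _; rewrite !coef_map /= IHm //; have := ltn_ord i; rewrite /bump; lia.
pose W s := epsilon (inhabits 0) (good s n).
have WP s : isGalEl iota s -> good s n (W s).
  by move=> Gs; apply: epsilon_spec; apply: good_ex.
have WM s t : isGalEl iota s -> isGalEl iota t -> forall m, (m <= n)%N ->
    (W (fun x => s (t x)))`_m = (W s * W t)`_m.
  move=> Gs Gt; apply: (good_uniq (fun x => s (t x))).
    exact/WP/gal_comp.
  have [g Dg] := gal_rmorphism Gs.
  move=> m mn; rewrite (WP t Gt) // rmorphM /= mulrA !coefM [in LHS]Dg rmorph_sum -Dg.
  apply: eq_bigr => i _; have im : (i <= n)%N by have := ltn_ord i; lia.
  rewrite [in LHS]Dg rmorphM -Dg XE // (WP s Gs) //; congr (_ * _).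
  by rewrite !coef_map /= fix_f.
have W0 s : isGalEl iota s -> (W s)`_0 = 1.
  move=> Gs; apply: (fmorph_inj f); rewrite rmorph1.
  have := WP s Gs 0 isT; rewrite coefM big_ord1 XE //= mul1r coef_map /= => <-.
  by have [g ->] := gal_rmorphism Gs; rewrite rmorph1.
have W1 s : isGalEl iota s -> (W s)`_1 = chi s.
  move=> Gs; apply: (fmorph_inj f).
  have := WP s Gs 1%N (ltnW n1); rewrite coefM !big_ord_recl big_ord0 addr0.
  rewrite !coef_map /= !XE ?(ltnW n1) //= W0 // rmorph1 mulr1 mul1r yP //.
  by move/addIr.
(* Once the [p ^ m]-th iterate fixes the coefficients up to degree [m], it translates [x m.+1] by an
   element of [F_p]; [p] further iterations kill this translation. *)
have x_fix m s : isGalEl iota s -> forall i, (i <= m)%N -> iter (p ^ m) s (x i) = x i.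
  move=> Gs; elim: m => [|m IHm] i.
    rewrite leqn0 => /eqP->; rewrite expn0 /=.
    by have [g ->] := gal_rmorphism Gs; rewrite rmorph1.
  rewrite expnS iterM; move: (gal_iter (p ^ m) Gs) IHm.
  move: (iter _ s) => {}s {}Gs IHm; have [g Dg] := gal_rmorphism Gs.
  rewrite leq_eqVlt => /predU1P[-> | im]; last first.
    by elim: {1}p => //= k ->; apply: IHm.
  have [u Du] : exists u, s (x m.+1) - x m.+1 = f u.
    apply: (Frobenius_fixed_Fp f p_pr); rewrite -frobE rmorphB /= !frobE xS.
    rewrite Dg -rmorphXn xS rmorphD rmorphM -Dg sa // (IHm m) //.
    by rewrite opprD addrACA subrr addr0.
  have iterE k : iter k s (x m.+1) = x m.+1 + k%:R * f u.
    elim: k => [|k IHk]; first by rewrite mul0r addr0.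
    rewrite iterS IHk Dg rmorphD rmorphM rmorph_nat -Dg fix_f //.
    by rewrite -[s _](subrK (x m.+1)) Du -natr1; ring.
  by rewrite iterE (pcharf0 pK) mul0r addr0.
(* The representation is the upper triangular Toeplitz matrix of [W s]. It is cut at degree [n]
   because only those coefficients are determined by the action of [s] on the [x i], as continuity
   requires. *)
apply: (@massey_contains_zero_of_unipotent _ _ _ _ _ _ _
          (fun i j s => if (j - i <= n)%N then (W s)`_(j - i) else 0)) => //.
- move=> i j; exists (mkseq x n.+1); split.
    move=> z /mapP[k]; rewrite mem_iota /= ltnS => kn ->{z}.
    case: pro_p => //=; apply: (in_max_p_ext_of_iter (m := n)) => // s Gs.
    exact: x_fix.
  move=> s t Gs Gt st; case: ifP => // jin.
  apply: (good_uniq t) => //; last exact: WP.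
  move=> m mn; rewrite -st ?WP //.
  by apply/mapP; exists m; rewrite // mem_iota.
- by move=> i s Gs _; rewrite subSnn ltnW ?W1.
- by move=> i s Gs _; rewrite subnn W0.
move=> i j s t Gs Gt i0 ij jn; rewrite ifT; last lia.
rewrite WM //; last lia.
rewrite coefM -[X in \big[_/_]_(X <= _ < _) _]add0n big_addn big_mkord.
rewrite subSn ?(ltnW ij) //.
apply: eq_bigr => l _; have := ltn_ord l => lij.
rewrite !ifT; [|lia|lia].
by congr (_`__ * _`__); lia.
Qed.

(** * Affine substitutions on power series *)

(* The image of [T^i] under the affine substitution [x -> k x + c], acting on
   power series in [T] through [1 + T = exp x]. *)
Definition affine_poly (R : comNzRingType) (c k i : nat) : {poly R} :=
  (1 + 'X) ^+ c * ((1 + 'X) ^+ k - 1) ^+ i.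

Lemma coef1M (R : nzRingType) (P Q : {poly R}) :
  (P * Q)`_1 = P`_0 * Q`_1 + P`_1 * Q`_0.
Proof. by rewrite coefM !big_ord_recl big_ord0 addr0. Qed.

Lemma coef1_expX1D (R : comNzRingType) (k : nat) :
  ((1 + 'X : {poly R}) ^+ k)`_0 = 1 /\ ((1 + 'X : {poly R}) ^+ k)`_1 = k%:R.
Proof.
elim: k => [|k [IH0 IH1]]; first by rewrite expr0 !coef1.
rewrite exprS coef0M coef1M IH0 IH1 !coefD !coef1 !coefX /=.
by rewrite addr0 add0r !mul1r natr1.
Qed.

Lemma affine_polyE (R : comNzRingType) (c k i : nat) :
  affine_poly R c k i =
  (1 + 'X) ^+ c * (\sum_(j < k) (1 + 'X) ^+ j) ^+ i * 'X^i.
Proof.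
by rewrite /affine_poly subrX1 addrAC subrr add0r exprMn mulrCA mulrC. Qed.

Lemma coef_affine_poly_lt (R : comNzRingType) (c k i j : nat) :
  (j < i)%N -> (affine_poly R c k i)`_j = 0.
Proof. by move=> ji; rewrite affine_polyE coefMXn ji. Qed.

(** [(1 + T)^k - 1 = T * Q] with [Q = k + 'C(k, 2) T + ...], so the hypotheses say that [Q] is 1
    modulo [T^2]. *)
Lemma coef_affine_poly_diag (R : comNzRingType) (c k i : nat) :
  k%:R = 1 :> R -> 'C(k, 2)%:R = 0 :> R ->
  (affine_poly R c k i)`_i = 1 /\ (affine_poly R c k i)`_i.+1 = c%:R.
Proof.
move=> k1 k2; rewrite affine_polyE !coefMXn ltnn ltnNge leqnSn subnn subSnn /=.
have [c0 c1] := coef1_expX1D R c.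
set Q := \sum_(j < k) _.
have Q0 : Q`_0 = 1.
  rewrite coef_sum -[RHS]k1 (eq_bigr (fun=> 1)) ?sumr_const ?card_ord // => j _.
  by have [-> _] := coef1_expX1D R j.
have Q1 : Q`_1 = 0.
  rewrite coef_sum -[RHS]k2 -bin2_sum big_mkord natr_sum; apply: eq_bigr => j _.
  by have [_ ->] := coef1_expX1D R j.
have [Qi0 Qi1] : (Q ^+ i)`_0 = 1 /\ (Q ^+ i)`_1 = 0.
  elim: i => [|i [IH0 IH1]]; first by rewrite expr0 !coef1.
  by rewrite exprS coef0M coef1M Q0 Q1 IH0 IH1 !mul1r mul0r addr0.
by rewrite coef0M coef1M c0 c1 Qi0 Qi1 !mulr1 mulr0 add0r.
Qed.

Lemma sum_nat_support (V : nmodType) (G : nat -> V) (a b N : nat) :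
  (a <= b <= N)%N -> (forall l, ~~ (a <= l < b)%N -> G l = 0) ->
  \sum_(0 <= l < N) G l = \sum_(a <= l < b) G l.
Proof.
move=> /andP[ab bN] G0.
rewrite (@big_cat_nat _ _ _ b) //= (@big_cat_nat _ _ _ a 0 b) //=.
rewrite [X in X + _ + _]big1_seq; last first.
  by move=> l /andP[_]; rewrite mem_index_iota => la; apply: G0; lia.
rewrite [X in _ + X]big1_seq ?add0r ?addr0 // => l /andP[_].
by rewrite mem_index_iota => la; apply: G0; lia.
Qed.

(** Composition of affine substitutions as a matrix product: replace [T] by [(1 + T)^k - 1] in the
    image of [T^i] under the second map, multiply by [(1 + T)^c], and expand. *)
Lemma coef_affine_poly_mul (R : comNzRingType) (c k c' k' i j : nat) :
  (i <= j)%N ->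
  (affine_poly R (c + k * c') (k * k') i)`_j =
  \sum_(i <= l < j.+1) (affine_poly R c k l)`_j * (affine_poly R c' k' i)`_l.
Proof.
move=> ij.
have -> : affine_poly R (c + k * c') (k * k') i =
    (1 + 'X) ^+ c * (affine_poly R c' k' i \Po ((1 + 'X) ^+ k - 1)).
  rewrite /affine_poly comp_polyM !rmorphXn !rmorphB /= !rmorphXn !rmorphD /=.
  rewrite !rmorph1 /= !comp_polyX [1 + (_ - _)]addrC subrK exprD -!exprM.
  by rewrite mulrA.
set P := affine_poly R c' k' i.
rewrite comp_polyE mulr_sumr coef_sum.
rewrite -(big_mkord xpredT (fun l => ((1 + 'X) ^+ c * (P`_l *: ((1 + 'X) ^+ k - 1) ^+ l))`_j)).
rewrite (eq_bigr (fun l => (affine_poly R c k l)`_j * P`_l)); last first.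
  by move=> l _; rewrite -scalerAr coefZ mulrC.
(* Both sums are compared on a common range, since the summand vanishes unless [i <= l <= j] and
   also beyond the size of [P]. *)
rewrite -(@sum_nat_support _ _ i j.+1 (size P + j.+1)); last first.
- move=> l; rewrite negb_and -ltnNge -leqNgt => /orP[li | jl].
    by rewrite [P`__]coef_affine_poly_lt // mulr0.
  by rewrite coef_affine_poly_lt // mul0r.
- by rewrite leqW // leq_addl.
rewrite (@sum_nat_support _ _ 0 (size P) (size P + j.+1)) ?leq_addr // => l.
by rewrite /= -leqNgt => szl; rewrite [P`__]nth_default // mulr0.
Qed.

(** In characteristic [p], [(1 + T)^(p^m) = 1 + T^(p^m)], which is 1 modulo [T^(p^m)]. *)
Lemma coef_affine_poly_mod (p m c k c' k' i j : nat) :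
  prime p -> (j < p ^ m)%N -> c = c' %[mod p ^ m] -> k = k' %[mod p ^ m] ->
  (affine_poly 'F_p c k i)`_j = (affine_poly 'F_p c' k' i)`_j.
Proof.
move=> p_pr jq cc' kk'; set q := (p ^ m)%N in jq cc' kk'.
pose E (A B : {poly 'F_p}) := forall j, (j < q)%N -> A`_j = B`_j.
have EM A A' B B' : E A A' -> E B B' -> E (A * B) (A' * B').
  move=> eA eB l lq; rewrite !coefM; apply: eq_bigr => u _.
  by rewrite eA ?eB //; have := ltn_ord u; lia.
have EX A A' u : E A A' -> E (A ^+ u) (A' ^+ u).
  by move=> eA; elim: u => // u IHu; rewrite !exprS; apply: EM.
have E1 u : E ((1 + 'X) ^+ u) ((1 + 'X) ^+ (u %% q)).
  rewrite {1}(divn_eq u q) exprD mulnC exprM -[X in E _ X]mul1r.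
  apply: EM => //; rewrite -[1 in X in E _ X](expr1n _ (u %/ q)); apply: EX.
  have pP : p \in [pchar {poly 'F_p}] by rewrite pchar_poly pchar_Fp.
  rewrite /q exprDn_pchar ?(pnatX, pnatE) ?pP // expr1n => l lq.
  by rewrite coefD coefXn (ltn_eqF lq) addr0.
apply: (EM _ _ _ _ _ _ j jq).
  by move=> l lq; rewrite E1 // cc' -E1.
by apply: EX => l lq; rewrite !coefB E1 // kk' -E1.
Qed.

(** * Radical extensions *)

Lemma sep_closed_root_exp (K : fieldType) (N : nat) (b : K) :
  sep_closed K -> (0 < N)%N -> N%:R != 0 :> K -> b != 0 ->
  exists x, x ^+ N = b.
Proof.
move=> sepK N0 NK b0.
have [||x] := sepK ('X^N - b%:P).
- by rewrite size_XnsubC // ltnS.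
- rewrite separable_poly.unlock derivB derivXn derivC subr0 -scaler_nat.
  rewrite coprimepZr //.
  have cX : coprimep ('X^N - b%:P) 'X.
    by rewrite coprimepX /root !hornerE expr0n (gtn_eqF N0) sub0r oppr_eq0.
  by rewrite coprimep_expr.
by rewrite /root !hornerE subr_eq0 => /eqP xb; exists x.
Qed.

(** By induction [t], the [p ^ m]-th iterate of [s], fixes [w ^+ p]; so it multiplies [w] by a power
    of [z], which the group fixes, and the [p]-th iterate of [t] fixes [w]. *)
Lemma kummer_iter (p m : nat) (F Om : fieldType) (iota : {rmorphism F -> Om})
    (z : Om) (w : Om) :
  p.-primitive_root z -> (forall s, isGalEl iota s -> s z = z) -> w != 0 ->
  (forall s, isGalEl iota s -> s (w ^+ (p ^ m)) = w ^+ (p ^ m)) ->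
  forall s, isGalEl iota s -> iter (p ^ m) s w = w.
Proof.
move=> zP sz; elim: m w => [|m IHm] w w0 sw s Gs; first exact: (sw s Gs).
rewrite expnS iterM.
have := IHm (w ^+ p) _ _ s Gs; rewrite expf_neq0 // => /(_ isT).
rewrite -exprM -expnS => /(_ sw).
move: (gal_iter (p ^ m) Gs); move: (iter _ s) => t Gt twp.
have [g Dg] := gal_rmorphism Gt.
have : (t w / w) ^+ p = 1.
  by rewrite expr_div_n Dg -rmorphXn -Dg twp divff // expf_neq0.
move/(prim_rootP zP) => [i /(canRL (divfK w0)) tw].
have iterE k : iter k t w = (z ^+ i) ^+ k * w.
  elim: k => [|k IHk]; first by rewrite mul1r.
  by rewrite iterS IHk Dg rmorphM !rmorphXn -Dg sz // tw mulrA -exprSr.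
by rewrite iterE exprAC (prim_expr_order zP) expr1n mul1r.
Qed.

(** * Kummer characters *)

(** The order of [w] divides [p ^ m.+1]; were it a smaller power of [p], [z] would be 1. *)
Lemma primitive_root_of_pfactor (K : fieldType) (p m : nat) (z w : K) :
  prime p -> p.-primitive_root z -> w ^+ (p ^ m) = z ->
  (p ^ m.+1).-primitive_root w.
Proof.
move=> p_pr zP wz.
have wq : w ^+ (p ^ m.+1) = 1 by rewrite expnSr exprM wz (prim_expr_order zP).
have q0 : (0 < p ^ m.+1)%N by rewrite expn_gt0 prime_gt0.
have [d dP /(dvdn_pfactor _ _ p_pr)[e em Dd]] := prim_order_exists q0 wq.
move: em; rewrite leq_eqVlt => /predU1P[<- | em]; first by rewrite -Dd.
have z1 : z = 1.
  apply/eqP; rewrite -wz -(prim_order_dvd dP) Dd; exact: dvdn_exp2l.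
have := prim_order_dvd zP 1; rewrite expr1 z1 eqxx dvdn1.
by have := prime_gt1 p_pr; case: eqP => // ->.
Qed.

(** As [2 * 'C(k, 2) = k * (k - 1)], divisibility of [k - 1] by [p] suffices for odd [p], and the
    factor 2 costs a divisibility by 4 when [p = 2]. *)
Lemma binomial2_Fp_eq0 (p k : nat) :
  prime p -> k = 1 %[mod p] -> (p = 2 -> k = 1 %[mod 4]) ->
  'C(k, 2)%:R = 0 :> 'F_p.
Proof.
move=> p_pr k1 k4; apply/eqP; rewrite -(dvdn_pcharf (pchar_Fp p_pr)).
have kpos : (0 < k)%N.
  by case: k k1 {k4} => // /eqP; rewrite mod0n modn_small ?prime_gt1.
have k1p : (p %| k.-1)%N by rewrite -subn1 -eqn_mod_dvd //; apply/eqP.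
have := mul_bin_diag k 1; rewrite bin1 => kC.
have [p2 | p_odd] := eqVneq p 2%N.
  have k14 : (4 %| k.-1)%N by rewrite -subn1 -eqn_mod_dvd //; apply/eqP/k4.
  rewrite p2 -(@dvdn_pmul2l 2) // -kC; exact: dvdn_mull.
have : (p %| 2 * 'C(k, 2))%N by rewrite -kC dvdn_mull.
by rewrite Euclid_dvdM // dvdn_prime2 // (negPf p_odd).
Qed.

(* With [zeta] a primitive [p ^ (n + 2)]-th root of unity and [Y] a
   [p ^ (n + 1)]-th root of the Kummer generator of [chi], the group acts through
   the affine maps [x -> kap s * x + c s], hence unipotently on truncated power
   series. That [kap s] is 1 modulo [p], and modulo 4 when [p = 2], kills the
   contribution ['C(kap s, 2)] of [kap s] to the superdiagonal. *)
Lemma massey_kummer (pro_p : bool) (p n : nat) (F Om : fieldType)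
    (iota : {rmorphism F -> Om}) (chi : (Om -> Om) -> 'F_p) (z0 : F) :
  (1 < n)%N -> prime p -> p \notin [pchar Om] -> p.-primitive_root z0 ->
  (p = 2 -> exists r : F, r ^+ 2 = -1) ->
  sep_closed Om -> sep_algebraic iota -> is_H1 pro_p iota chi ->
  massey_contains_zero pro_p iota n (fun _ => chi).
Proof.
move=> n1 p_pr pK z0P iP sepO algO [[S [_ chiS]] chiM].
have pn0 m : (p ^ m)%:R != 0 :> Om.
  rewrite natrX expf_neq0 //; move: pK; rewrite inE p_pr; exact.
have chiD s t : isGalEl iota s -> isGalEl iota t ->
    chi (fun x => s (t x)) = chi s + chi t.
  move=> Gs Gt; have /eqP := chiM s t Gs Gt.
  by rewrite /delta1 addrAC subr_eq0 addrC => /eqP.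
pose z := iota z0.
have zP : p.-primitive_root z by rewrite fmorph_primitive_root.
have z_neq0 : z != 0 by rewrite (prim_root_eq0 zP) -lt0n prime_gt0.
have sz s : isGalEl iota s -> s z = z by case=> _ _ _ _; apply.
have szX s k : isGalEl iota s -> s (z ^+ k) = z ^+ k.
  by move=> Gs; have [g Dg] := gal_rmorphism Gs; rewrite Dg rmorphXn -Dg sz.
have [y y0 yP] : exists2 y, y != 0 &
    forall s, isGalEl iota s -> s y = z ^+ chi s * y.
  apply: (hilbert90_mul (S := S)) => //.
  - by move=> s t Gs Gt st; rewrite (chiS s t).
  - by move=> s Gs; rewrite expf_neq0.
  - move=> s t Gs Gt; rewrite chiD // -exprD; apply/eqP.
    rewrite (eq_prim_root_expr zP) -!val_Fp_nat // natrD !natr_Zp.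
    by rewrite -[chi s + chi t]natr_Zp.
  - by move=> s t Gs Gt; apply: szX.
have q0 m : (0 < p ^ m)%N by rewrite expn_gt0 prime_gt0.
have [zeta zetaE] := sep_closed_root_exp sepO (q0 n.+1) (pn0 _) z_neq0.
have [Y YE] := sep_closed_root_exp sepO (q0 n.+1) (pn0 _) y0.
have zetaP := primitive_root_of_pfactor p_pr zP zetaE.
have zeta0 : zeta != 0 by rewrite (prim_root_eq0 zetaP) -lt0n.
have Y0 : Y != 0 by apply: contraNneq y0 => Y0; rewrite -YE Y0 expr0n gtn_eqF.
set q := (p ^ n.+2)%N in zetaP.
have Dq : q = (p * p ^ n.+1)%N by rewrite -expnS.
(* Discrete logarithm to base [zeta]; the default 0 serves only elements that are not [q]-th roots
   of unity. *)
pose dlog (w : Om) := if [pick i : 'I_q | w == zeta ^+ i] is Some i then i : nat else 0%N.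
have dlogE w : w ^+ q = 1 -> zeta ^+ dlog w = w.
  move=> wq; rewrite /dlog; case: pickP => [i /eqP-> // | no_i].
  by have [i wi] := prim_rootP zetaP wq; have := no_i i; rewrite wi eqxx.
pose kap (s : Om -> Om) := dlog (s zeta).
pose c (s : Om -> Om) := dlog (s Y / Y).
have kapE s : isGalEl iota s -> s zeta = zeta ^+ kap s.
  move=> Gs; rewrite dlogE //; have [g ->] := gal_rmorphism Gs.
  by rewrite -rmorphXn (prim_expr_order zetaP) rmorph1.
have cE s : isGalEl iota s -> s Y = zeta ^+ c s * Y.
  move=> Gs; rewrite dlogE ?divfK //; have [g Dg] := gal_rmorphism Gs.
  rewrite /q expnSr exprM expr_div_n Dg -rmorphXn -Dg YE yP // mulfK //.
  by rewrite exprAC (prim_expr_order zP) expr1n.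
(* [zeta ^+ e] has order [m], and [s] raises it to the power [kap s]. *)
have kap_mod s (m e : nat) : isGalEl iota s -> q = (m * e)%N -> (0 < e)%N ->
    s (zeta ^+ e) = zeta ^+ e -> kap s = 1 %[mod m].
  move=> Gs Dme e0 se; have [g Dg] := gal_rmorphism Gs.
  have : zeta ^+ (kap s * e) == zeta ^+ (1 * e).
    by rewrite exprM -kapE // mul1n -[X in _ == X]se Dg rmorphXn.
  rewrite (eq_prim_root_expr zetaP) Dme -!muln_modl eqn_pmul2r //.
  by move/eqP.
have kap1 s : isGalEl iota s -> kap s = 1 %[mod p].
  by move=> Gs; apply: (kap_mod s _ _ Gs Dq) => //; rewrite zetaE sz.
have kap4 s : isGalEl iota s -> p = 2%N -> kap s = 1 %[mod 4].
  move=> Gs p2; have [g Dg] := gal_rmorphism Gs.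
  apply: (kap_mod s 4 (p ^ n)%N) => //.
    by rewrite /q p2 !expnS mulnA.
  (* For [p = 2], [zeta ^+ (p ^ n)] is a square root of [z = -1], hence up to sign the one coming
     from [F], so it is fixed. *)
  have [r0 r0E] := iP p2; have sr : s (iota r0) = iota r0 by case: Gs.
  have zN1 : z = -1.
    have : z ^+ 2 == 1 ^+ 2 by rewrite -{1}p2 (prim_expr_order zP) expr1n.
    rewrite eqf_sqr => /orP[/eqP z1 | /eqP //].
    by have := prim_order_dvd zP 1; rewrite expr1 z1 eqxx dvdn1 p2.
  have : (zeta ^+ (p ^ n)) ^+ 2 == iota r0 ^+ 2.
    by rewrite -exprM -[X in (_ * X)%N]p2 -expnSr zetaE zN1 -rmorphXn r0E rmorphN1.
  rewrite eqf_sqr => /orP[] /eqP->; first exact: sr.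
  by rewrite Dg rmorphN -Dg sr.
have kapM s t : isGalEl iota s -> isGalEl iota t ->
    kap (fun x => s (t x)) = kap s * kap t %[mod q].
  move=> Gs Gt; apply/eqP; rewrite -(eq_prim_root_expr zetaP).
  rewrite -kapE ?(kapE t) //; last exact: gal_comp.
  by have [g Dg] := gal_rmorphism Gs; rewrite Dg rmorphXn -Dg kapE // exprM.
have cM s t : isGalEl iota s -> isGalEl iota t ->
    c (fun x => s (t x)) = c s + kap s * c t %[mod q].
  move=> Gs Gt; apply/eqP; rewrite -(eq_prim_root_expr zetaP).
  apply/eqP/(mulIf Y0); rewrite -cE ?(cE t) //; last exact: gal_comp.
  have [g Dg] := gal_rmorphism Gs.
  rewrite Dg rmorphM rmorphXn -Dg kapE // cE // mulrA; congr (_ * _).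
  by rewrite -exprM -exprD addnC.
have c_chi s : isGalEl iota s -> (c s)%:R = chi s.
  move=> Gs; have [g Dg] := gal_rmorphism Gs.
  have : z ^+ c s == z ^+ chi s.
    apply/eqP/(mulIf y0); rewrite -yP // -YE Dg rmorphXn -Dg cE // exprMn.
    by rewrite exprAC zetaE.
  rewrite (eq_prim_root_expr zP) => /eqP cchi; apply: val_inj.
  by rewrite /= val_Fp_nat // cchi modn_small // -[X in (_ < X)%N](Fp_cast p_pr).
have kapF s : isGalEl iota s -> (kap s)%:R = 1 :> 'F_p.
  by move=> Gs; apply: val_inj; rewrite [LHS]val_Fp_nat // kap1 // -val_Fp_nat.
have kapF2 s : isGalEl iota s -> 'C(kap s, 2)%:R = 0 :> 'F_p.
  by move=> Gs; apply: binomial2_Fp_eq0 => //; [apply: kap1 | apply: kap4].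
have nq : (n.+2 < q)%N by apply: ltn_expl; apply: prime_gt1.
have root_fix w : w != 0 -> (forall s, isGalEl iota s -> s (w ^+ q) = w ^+ q) ->
    adm pro_p p iota w.
  move=> w0 sw; case: pro_p => //=.
  apply: (in_max_p_ext_of_iter (m := n.+2)) => //.
  exact: (kummer_iter zP sz w0 sw).
(* Entry [(i, j)] is the coefficient of [T^(n+1-i)] in the image of [T^(n+1-j)]: the basis is listed
   by decreasing degree to make the matrix upper triangular. *)
apply: (@massey_contains_zero_of_unipotent _ _ _ _ _ _ _
  (fun i j s => (affine_poly 'F_p (c s) (kap s) (n.+1 - j))`_(n.+1 - i))) => //.
- move=> i j; exists [:: zeta; Y]; split.
    move=> w; rewrite !inE => /orP[] /eqP ->; apply: root_fix => // s Gs.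
      by have [g ->] := gal_rmorphism Gs; rewrite (prim_expr_order zetaP) rmorph1.
    have [g Dg] := gal_rmorphism Gs.
    rewrite /q expnSr exprM YE Dg rmorphXn -Dg yP // exprMn exprAC.
    by rewrite (prim_expr_order zP) expr1n mul1r.
  move=> s t _ _ st.
  by rewrite /c /kap (st zeta) ?(st Y) // !inE eqxx ?orbT.
- move=> i s Gs ni; have -> : (n.+1 - i.+1 = (n.+1 - i.+2).+1)%N by lia.
  have [_ ->] := coef_affine_poly_diag (c s) (n.+1 - i.+2) (kapF s Gs) (kapF2 s Gs).
  exact: c_chi.
- move=> i s Gs _.
  by have [-> _] := coef_affine_poly_diag (c s) (n.+1 - i) (kapF s Gs) (kapF2 s Gs).
move=> i j s t Gs Gt i0 ij jn.
(* The composition laws of [c] and [kap] hold only modulo [q], which suffices because [q] exceeds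
   all degrees involved. *)
rewrite (coef_affine_poly_mod _ p_pr _ (cM s t Gs Gt) (kapM s t Gs Gt)); last first.
  by rewrite -/q; lia.
rewrite coef_affine_poly_mul; last lia.
rewrite -[X in \big[_/_]_(X <= _ < _) _ = _]add0n big_addn.
rewrite -[X in _ = \big[_/_]_(X <= _ < _) _]add0n big_addn big_nat_rev /=.
have -> : ((n.+1 - i).+1 - (n.+1 - j) = j.+1 - i)%N by lia.
apply: eq_big_nat => l /andP[_ lij].
by congr ((affine_poly _ _ _ _)`__ * (affine_poly _ _ _ _)`__); lia.
Qed.

Theorem theorem8p1 (p : nat) (n : nat) (F Om : fieldType)
  (iota : {rmorphism F -> Om}) (pro_p : bool) :
  prime p -> (3 <= n)%N ->
  (p \notin [pchar F] -> exists z : F, p.-primitive_root z) ->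
  (p = 2%N -> exists r : F, r ^+ 2 = -1) ->
  sep_closed Om -> sep_algebraic iota ->
  forall chi : (Om -> Om) -> 'F_p,
    is_H1 pro_p iota chi ->
    massey_contains_zero pro_p iota n (fun _ => chi).
Proof.
move=> p_pr n3 zF iF sepO algO chi chiH1; have n1 : (1 < n)%N := ltnW n3.
have pE := fmorph_pchar iota p.
case: (boolP (p \in [pchar F])) => pF.
  by apply: massey_pchar => //; rewrite pE.
have [z zP] := zF pF.
by apply: (massey_kummer n1 p_pr _ zP) => //; rewrite pE.
Qed.
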